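(* Over $\mathsf{RCA}_0$, $\mathsf{SEM}+\mathsf{SADS}$ implies $\mathsf{SRT}^2_2$.
   Context: All principles are statements of second order arithmetic; infinite structures have domain $\mathbb{N}$. An infinite tournament is an irreflexive binary relation $T$ on $\mathbb{N}$ such that for all $x\neq y$ exactly one of $T(x,y)$, $T(y,x)$ holds. It is stable if for all $x$ there is a $y$ such that either $T(x,z)$ holds for all $z>y$ or $T(z,x)$ holds for all $z>y$. $\mathsf{SEM}$: every infinite stable tournament contains an infinite transitive subtournament, i.e. an infinite set $S$ on which the relation $T$ is transitive. An infinite linear order $L=(\mathbb{N},<_L)$ is stable if it has order type $\omega+\omega^*$, which means: for every $x$ there is a $y$ such that either $x<_L z$ for all $z>y$ or $z<_L x$ for all $z>y$. $\mathsf{SADS}$: for every infinite stable linear order there is an $f:\mathbb{N}\to\mathbb{N}$ with either $f(n)<_L f(m)$ for all $n<m$, or $f(n)>_L f(m)$ for all $n<m$. A 2-coloring $c:[\mathbb{N}]^2\to\{0,1\}$ is stable if for every $n$ there is an $i\in\{0,1\}$ such that $c(n,y)=i$ for all but finitely many $y$. $\mathsf{SRT}^2_2$: every stable 2-coloring of $[\mathbb{N}]^2$ has an infinite homogeneous set, i.e. an infinite $H$ with $c$ constant on $[H]^2$. *)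

(* Defs.v *)
From Stdlib Require Import Arith.

(* Two independent families of de Bruijn variables: number variables occur in
   terms, set variables occur only to the right of membership.  A number
   quantifier binds number variable 0 and leaves the set indices alone, and
   conversely. *)

Inductive term : Type :=
| Var (n : nat)
| Zero
| One
| Add (s t : term)
| Mul (s t : term).

Inductive form : Type :=
| Eq (s t : term)
| Lt (s t : term)
| Mem (t : term) (X : nat)
| Not (A : form)
| And (A B : form)
| Or (A B : form)
| Imp (A B : form)
| Iff (A B : form)
| All (A : form)
| Ex (A : form)
| AllS (A : form)
| ExS (A : form).

Declare Scope term_scope.
Declare Scope form_scope.
Delimit Scope term_scope with term.
Delimit Scope form_scope with form.
Bind Scope term_scope with term.
Bind Scope form_scope with form.

Notation "# n" := (Var n%nat) (at level 1, n at level 0, format "# n") : term_scope.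
Notation "0" := Zero : term_scope.
Notation "1" := One : term_scope.
Notation "2" := (Add One One) : term_scope.
Infix "+" := Add : term_scope.
Infix "*" := Mul : term_scope.

Notation "s = t" := (Eq s t) : form_scope.
Notation "s < t" := (Lt s t) : form_scope.
Notation "t ∈ X" := (Mem t X%nat) (at level 70, no associativity) : form_scope.
Notation "~ A" := (Not A) : form_scope.
Notation "A /\ B" := (And A B) : form_scope.
Notation "A \/ B" := (Or A B) : form_scope.
Notation "A -> B" := (Imp A B) : form_scope.
Notation "A <-> B" := (Iff A B) : form_scope.
Notation "∀ A" := (All A) (at level 75, right associativity) : form_scope.
Notation "∃ A" := (Ex A) (at level 75, right associativity) : form_scope.
Notation "∀² A" := (AllS A) (at level 75, right associativity) : form_scope.
Notation "∃² A" := (ExS A) (at level 75, right associativity) : form_scope.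

Definition scons {T : Type} (x : T) (f : nat -> T) (n : nat) : T :=
  match n with 0 => x | S k => f k end.

Fixpoint tsubst (σ : nat -> term) (t : term) : term :=
  match t with
  | Var n => σ n
  | Zero => Zero
  | One => One
  | Add s t => Add (tsubst σ s) (tsubst σ t)
  | Mul s t => Mul (tsubst σ s) (tsubst σ t)
  end.

Definition tshift : term -> term := tsubst (fun n => Var (S n)).

Definition up (σ : nat -> term) : nat -> term :=
  scons (Var 0) (fun n => tshift (σ n)).

Fixpoint subst (σ : nat -> term) (A : form) : form :=
  match A with
  | Eq s t => Eq (tsubst σ s) (tsubst σ t)
  | Lt s t => Lt (tsubst σ s) (tsubst σ t)
  | Mem t X => Mem (tsubst σ t) X
  | Not A => Not (subst σ A)
  | And A B => And (subst σ A) (subst σ B)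
  | Or A B => Or (subst σ A) (subst σ B)
  | Imp A B => Imp (subst σ A) (subst σ B)
  | Iff A B => Iff (subst σ A) (subst σ B)
  | All A => All (subst (up σ) A)
  | Ex A => Ex (subst (up σ) A)
  | AllS A => AllS (subst σ A)
  | ExS A => ExS (subst σ A)
  end.

Definition upS (ρ : nat -> nat) : nat -> nat := scons 0 (fun n => S (ρ n)).

Fixpoint renS (ρ : nat -> nat) (A : form) : form :=
  match A with
  | Eq s t => Eq s t
  | Lt s t => Lt s t
  | Mem t X => Mem t (ρ X)
  | Not A => Not (renS ρ A)
  | And A B => And (renS ρ A) (renS ρ B)
  | Or A B => Or (renS ρ A) (renS ρ B)
  | Imp A B => Imp (renS ρ A) (renS ρ B)
  | Iff A B => Iff (renS ρ A) (renS ρ B)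
  | All A => All (renS ρ A)
  | Ex A => Ex (renS ρ A)
  | AllS A => AllS (renS (upS ρ) A)
  | ExS A => ExS (renS (upS ρ) A)
  end.

(* Henkin semantics: the first order part is arbitrary (possibly nonstandard)
   and the set quantifiers range over a designated nonempty collection of
   subsets of it. *)
Record structure : Type := {
  dom : Type;
  zero : dom;
  one : dom;
  add : dom -> dom -> dom;
  mul : dom -> dom -> dom;
  lt : dom -> dom -> Prop;
  is_set : (dom -> Prop) -> Prop;
  is_set_inhabited : exists X, is_set X
}.

Section Satisfaction.

Variable M : structure.

Fixpoint eval (e : nat -> dom M) (t : term) : dom M :=
  match t with
  | Var n => e n
  | Zero => zero M
  | One => one M
  | Add s t => add M (eval e s) (eval e t)
  | Mul s t => mul M (eval e s) (eval e t)
  end.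

Fixpoint sat (e : nat -> dom M) (E : nat -> dom M -> Prop) (A : form) : Prop :=
  match A with
  | Eq s t => eval e s = eval e t
  | Lt s t => lt M (eval e s) (eval e t)
  | Mem t X => E X (eval e t)
  | Not A => ~ sat e E A
  | And A B => sat e E A /\ sat e E B
  | Or A B => sat e E A \/ sat e E B
  | Imp A B => sat e E A -> sat e E B
  | Iff A B => sat e E A <-> sat e E B
  | All A => forall x : dom M, sat (scons x e) E A
  | Ex A => exists x : dom M, sat (scons x e) E A
  | AllS A => forall X : dom M -> Prop, is_set M X -> sat e (scons X E) A
  | ExS A => exists X : dom M -> Prop, is_set M X /\ sat e (scons X E) A
  end.

(* Truth of the universal closure: free variables act as parameters. *)
Definition models (A : form) : Prop :=
  forall e E, (forall n, is_set M (E n)) -> sat e E A.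

End Satisfaction.

Definition consequence (Γ : form -> Prop) (A : form) : Prop :=
  forall M : structure, (forall B, Γ B -> models M B) -> models M A.

Inductive Delta00 : form -> Prop :=
| Delta00_eq s t : Delta00 (s = t)
| Delta00_lt s t : Delta00 (s < t)
| Delta00_mem t X : Delta00 (t ∈ X)
| Delta00_not A : Delta00 A -> Delta00 (~ A)
| Delta00_and A B : Delta00 A -> Delta00 B -> Delta00 (A /\ B)
| Delta00_or A B : Delta00 A -> Delta00 B -> Delta00 (A \/ B)
| Delta00_imp A B : Delta00 A -> Delta00 B -> Delta00 (A -> B)
| Delta00_iff A B : Delta00 A -> Delta00 B -> Delta00 (A <-> B)
(* [tshift] keeps the bound variable out of the bounding term *)
| Delta00_ball t A : Delta00 A -> Delta00 (∀ (#0 < tshift t -> A))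
| Delta00_bex t A : Delta00 A -> Delta00 (∃ (#0 < tshift t /\ A)).

Inductive Sigma01 : form -> Prop :=
| Sigma01_ex A : Delta00 A -> Sigma01 (∃ A).

Inductive Pi01 : form -> Prop :=
| Pi01_all A : Delta00 A -> Pi01 (∀ A).

Definition induction (A : form) : form :=
  subst (scons Zero Var) A /\
  (∀ (A -> subst (scons (#0 + 1)%term (fun n => Var (S n))) A)) ->
  ∀ A.

(* [renS S] makes room for the set variable bound by [ExS], so that the set
   being defined is not free in [A]. *)
Definition comprehension (A B : form) : form :=
  (∀ (A <-> B)) -> ∃² ∀ (#0 ∈ 0 <-> renS S A).

Inductive RCA0 : form -> Prop :=
| ax_succ_ne_zero : RCA0 (~ (#0 + 1 = 0))
| ax_succ_inj : RCA0 (#0 + 1 = #1 + 1 -> #0 = #1)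
| ax_add_zero : RCA0 (#0 + 0 = #0)
| ax_add_succ : RCA0 (#0 + (#1 + 1) = (#0 + #1) + 1)
| ax_mul_zero : RCA0 (#0 * 0 = 0)
| ax_mul_succ : RCA0 (#0 * (#1 + 1) = (#0 * #1) + #0)
| ax_not_lt_zero : RCA0 (~ (#0 < 0))
| ax_lt_succ : RCA0 (#0 < #1 + 1 <-> #0 < #1 \/ #0 = #1)
| ax_Sigma01_induction A : Sigma01 A -> RCA0 (induction A)
| ax_Delta01_comprehension A B :
    Sigma01 A -> Pi01 B -> RCA0 (comprehension A B).

(* The usual pairing code (s + t)^2 + s of RCA0. *)
Definition pair (s t : term) : term := (s + t) * (s + t) + s.

Definition infinite (X : nat) : form := ∀ ∃ (#1 < #0 /\ #0 ∈ X).

Definition relation (R : nat) : form :=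
  ∀ (#0 ∈ R -> ∃ ∃ (#2 = pair #1 #0)).

Definition tournament (T : nat) : form :=
  relation T /\
  (∀ ~ (pair #0 #0 ∈ T)) /\
  (∀ ∀ (~ (#1 = #0) ->
        (pair #1 #0 ∈ T /\ ~ (pair #0 #1 ∈ T)) \/
        (pair #0 #1 ∈ T /\ ~ (pair #1 #0 ∈ T)))).

(* Used for tournaments and for linear orders alike: for every x = #2 there is
   y = #1 such that all z = #0 beyond y lie on the same side of x. *)
Definition stable (R : nat) : form :=
  ∀ ∃ ((∀ (#1 < #0 -> pair #2 #0 ∈ R)) \/ (∀ (#1 < #0 -> pair #0 #2 ∈ R))).

Definition transitive_on (T S : nat) : form :=
  ∀ ∀ ∀ (#2 ∈ S -> #1 ∈ S -> #0 ∈ S ->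
         pair #2 #1 ∈ T -> pair #1 #0 ∈ T -> pair #2 #0 ∈ T).

Definition SEM : form :=
  ∀² (tournament 0 /\ stable 0 ->
      ∃² (infinite 0 /\ transitive_on 1 0)).

Definition linear_order (L : nat) : form :=
  relation L /\
  (∀ ~ (pair #0 #0 ∈ L)) /\
  (∀ ∀ ∀ (pair #2 #1 ∈ L -> pair #1 #0 ∈ L -> pair #2 #0 ∈ L)) /\
  (∀ ∀ (pair #1 #0 ∈ L \/ #1 = #0 \/ pair #0 #1 ∈ L)).

Definition function (F : nat) : form :=
  relation F /\
  ∀ ∃ (pair #1 #0 ∈ F /\ ∀ (pair #2 #0 ∈ F -> #0 = #1)).

(* n = #3, m = #2, F(n) = #1, F(m) = #0 *)
Definition ascending (L F : nat) : form :=
  ∀ ∀ ∀ ∀ (#3 < #2 -> pair #3 #1 ∈ F -> pair #2 #0 ∈ F -> pair #1 #0 ∈ L).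

Definition descending (L F : nat) : form :=
  ∀ ∀ ∀ ∀ (#3 < #2 -> pair #3 #1 ∈ F -> pair #2 #0 ∈ F -> pair #0 #1 ∈ L).

Definition SADS : form :=
  ∀² (linear_order 0 /\ stable 0 ->
      ∃² (function 0 /\ (ascending 1 0 \/ descending 1 0))).

(* [N]^2 is the set of pairs (x, y) with x < y, and a 2-coloring is the graph
   of a function from it to {0, 1}. *)
Definition coloring (C : nat) : form :=
  (∀ (#0 ∈ C -> ∃ ∃ ∃ (#2 < #1 /\ #0 < 2 /\ #3 = pair (pair #2 #1) #0))) /\
  (∀ ∀ (#1 < #0 ->
        ∃ (#0 < 2 /\ pair (pair #2 #1) #0 ∈ C /\
           ∀ (pair (pair #3 #2) #0 ∈ C -> #0 = #1)))).

(* n = #3, i = #2, b = #1, y = #0; the clause n < y only discards finitely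
   many y. *)
Definition stable_coloring (C : nat) : form :=
  ∀ ∃ (#0 < 2 /\
       ∃ ∀ (#1 < #0 -> #3 < #0 -> pair (pair #3 #0) #2 ∈ C)).

Definition homogeneous (C H : nat) : form :=
  ∃ (#0 < 2 /\
     ∀ ∀ (#1 ∈ H -> #0 ∈ H -> #1 < #0 -> pair (pair #1 #0) #2 ∈ C)).

Definition SRT22 : form :=
  ∀² (coloring 0 /\ stable_coloring 0 ->
      ∃² (infinite 0 /\ homogeneous 1 0)).

(* Readable forms of the three sentences, valid by unfolding [sat]. *)

Section Unfolded.

Variable M : structure.

Local Notation "x ⊕ y" := (add M x y) (at level 50, left associativity).
Local Notation "x ≺ y" := (lt M x y) (at level 70).
Local Notation "⟨ x , y ⟩" := (add M (mul M (x ⊕ y) (x ⊕ y)) x).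
Local Notation two := (one M ⊕ one M).

Lemma models_SEM :
  models M SEM <->
  forall T, is_set M T ->
    ((forall n, T n -> exists x y, n = ⟨x, y⟩) /\
     (forall x, ~ T ⟨x, x⟩) /\
     (forall x y, ~ x = y ->
        (T ⟨x, y⟩ /\ ~ T ⟨y, x⟩) \/ (T ⟨y, x⟩ /\ ~ T ⟨x, y⟩))) /\
    (forall x, exists y,
        (forall z, y ≺ z -> T ⟨x, z⟩) \/ (forall z, y ≺ z -> T ⟨z, x⟩)) ->
    exists S, is_set M S /\
      (forall b, exists x, b ≺ x /\ S x) /\
      (forall x y z, S x -> S y -> S z -> T ⟨x, y⟩ -> T ⟨y, z⟩ -> T ⟨x, z⟩).
Proof.
  split.
  - destruct (is_set_inhabited M) as [X0 HX0]. intro H.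
    exact (H (fun _ => zero M) (fun _ => X0) (fun _ => HX0)).
  - intros H e E _. exact H.
Qed.

Lemma models_SADS :
  models M SADS <->
  forall L, is_set M L ->
    ((forall n, L n -> exists x y, n = ⟨x, y⟩) /\
     (forall x, ~ L ⟨x, x⟩) /\
     (forall x y z, L ⟨x, y⟩ -> L ⟨y, z⟩ -> L ⟨x, z⟩) /\
     (forall x y, L ⟨x, y⟩ \/ x = y \/ L ⟨y, x⟩)) /\
    (forall x, exists y,
        (forall z, y ≺ z -> L ⟨x, z⟩) \/ (forall z, y ≺ z -> L ⟨z, x⟩)) ->
    exists F, is_set M F /\
      ((forall n, F n -> exists x y, n = ⟨x, y⟩) /\
       (forall n, exists a, F ⟨n, a⟩ /\ forall b, F ⟨n, b⟩ -> b = a)) /\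
      ((forall n m a b, n ≺ m -> F ⟨n, a⟩ -> F ⟨m, b⟩ -> L ⟨a, b⟩) \/
       (forall n m a b, n ≺ m -> F ⟨n, a⟩ -> F ⟨m, b⟩ -> L ⟨b, a⟩)).
Proof.
  split.
  - destruct (is_set_inhabited M) as [X0 HX0]. intro H.
    exact (H (fun _ => zero M) (fun _ => X0) (fun _ => HX0)).
  - intros H e E _. exact H.
Qed.

Lemma models_SRT22 :
  models M SRT22 <->
  forall C, is_set M C ->
    ((forall n, C n -> exists x y i, x ≺ y /\ i ≺ two /\ n = ⟨⟨x, y⟩, i⟩) /\
     (forall x y, x ≺ y -> exists i, i ≺ two /\ C ⟨⟨x, y⟩, i⟩ /\
        forall j, C ⟨⟨x, y⟩, j⟩ -> j = i)) /\
    (forall n, exists i, i ≺ two /\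
        exists b, forall y, b ≺ y -> n ≺ y -> C ⟨⟨n, y⟩, i⟩) ->
    exists H, is_set M H /\
      (forall b, exists x, b ≺ x /\ H x) /\
      (exists i, i ≺ two /\
         forall x y, H x -> H y -> x ≺ y -> C ⟨⟨x, y⟩, i⟩).
Proof.
  split.
  - destruct (is_set_inhabited M) as [X0 HX0]. intro H.
    exact (H (fun _ => zero M) (fun _ => X0) (fun _ => HX0)).
  - intros H e E _. exact H.
Qed.

End Unfolded.

(* Main.v *)
(* A stable coloring is read as a stable tournament T: an edge colored 1 points
   upwards, an edge colored 0 downwards.  On a transitive infinite set S the
   tournament is a stable linear order; pulled back to all numbers along the
   map sending x to the least element of S that is at least x, it has a
   monotone sequence, whose image in S is then thinned to an increasing
   sequence.  The one delicate point is that a sequence injective into the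
   numbers is unbounded: Sigma01 induction gives this without any coding of
   finite sets, by multiplying pairwise coprime moduli indexed by the values. *)

From Stdlib Require Import Ring Setoid Classical.
Require Import Defs.

Local Open Scope form_scope.

(** * Substitution and renaming under the Henkin semantics *)

Lemma eval_ext (M : structure) t e e' :
  (forall n, e n = e' n) -> eval M e t = eval M e' t.
Proof. intro H; induction t; simpl; congruence. Qed.

Lemma eval_tsubst (M : structure) σ t e :
  eval M e (tsubst σ t) = eval M (fun n => eval M e (σ n)) t.
Proof. induction t; simpl; congruence. Qed.

Lemma eval_up (M : structure) σ x e n :
  eval M (scons x e) (up σ n) = scons x (fun k => eval M e (σ k)) n.
Proof.
  destruct n as [|n]; [reflexivity|].
  simpl; unfold tshift; rewrite eval_tsubst; reflexivity.
Qed.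

Lemma sat_ext (M : structure) A : forall e e' E E',
  (forall n, e n = e' n) -> (forall n x, E n x <-> E' n x) ->
  (sat M e E A <-> sat M e' E' A).
Proof.
  assert (Hs : forall T (x : T) f g, (forall n : nat, f n = g n) ->
    forall n, scons x f n = scons x g n) by (intros T x f g H [|n]; simpl; auto).
  assert (HS : forall (X : dom M -> Prop) F G,
    (forall n x, F n x <-> G n x) -> forall n x, scons X F n x <-> scons X G n x)
    by (intros X F G H [|n] x; simpl; [reflexivity | apply H]).
  induction A; intros e e' E E' He HE; simpl;
    try (rewrite (eval_ext M s _ _ He), (eval_ext M t _ _ He); reflexivity);
    try (rewrite (IHA1 _ _ _ _ He HE), (IHA2 _ _ _ _ He HE); reflexivity).
  - rewrite (eval_ext M t _ _ He); apply HE.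
  - rewrite (IHA _ _ _ _ He HE); reflexivity.
  - split; intros H x; generalize (H x); apply IHA; auto; intro; symmetry; auto.
  - split; intros [x H]; exists x; revert H; apply IHA; auto; intro; symmetry; auto.
  - split; intros H X HX; generalize (H X HX); apply IHA; auto;
      intros; symmetry; auto; apply HS; auto.
  - split; intros (X & HX & H); exists X; split; auto; revert H; apply IHA; auto;
      intros; symmetry; auto; apply HS; auto.
Qed.

Lemma sat_subst (M : structure) A : forall σ e E,
  sat M e E (subst σ A) <-> sat M (fun n => eval M e (σ n)) E A.
Proof.
  assert (Hup : forall A σ x e E,
    sat M (fun n => eval M (scons x e) (up σ n)) E A <->
    sat M (scons x (fun n => eval M e (σ n))) E A)
    by (intros; apply sat_ext; [intro; apply eval_up | reflexivity]).
  induction A; intros σ e E; simpl;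
    try (rewrite !eval_tsubst; reflexivity);
    try (rewrite IHA1, IHA2; reflexivity).
  - rewrite IHA; reflexivity.
  - split; intros H x; generalize (H x); rewrite IHA, Hup; auto.
  - split; intros [x H]; exists x; revert H; rewrite IHA, Hup; auto.
  - split; intros H X HX; generalize (H X HX); apply IHA.
  - split; intros (X & HX & H); exists X; split; auto; revert H; apply IHA.
Qed.

Lemma sat_renS (M : structure) A : forall ρ e E,
  sat M e E (renS ρ A) <-> sat M e (fun n => E (ρ n)) A.
Proof.
  assert (Hup : forall A ρ (X : dom M -> Prop) e E,
    sat M e (fun n => scons X E (upS ρ n)) A <->
    sat M e (scons X (fun n => E (ρ n))) A)
    by (intros; apply sat_ext; [reflexivity | intros [|n] x; reflexivity]).
  induction A; intros ρ e E; simpl; try reflexivity;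
    try (rewrite IHA1, IHA2; reflexivity).
  - rewrite IHA; reflexivity.
  - split; intros H x; generalize (H x); apply IHA.
  - split; intros [x H]; exists x; revert H; apply IHA.
  - split; intros H X HX; generalize (H X HX); rewrite IHA, Hup; auto.
  - split; intros (X & HX & H); exists X; split; auto; revert H; rewrite IHA, Hup; auto.
Qed.

(** The constructors of [Delta00] for bounded quantifiers ask for a bounding term of the form
    [tshift t]; this identity keeps that form under substitution. *)
Lemma tsubst_up_tshift σ t : tsubst (up σ) (tshift t) = tshift (tsubst σ t).
Proof. induction t; simpl; unfold tshift in *; simpl; congruence. Qed.

Lemma Delta00_subst A : Delta00 A -> forall σ, Delta00 (subst σ A).
Proof.
  induction 1; intro σ; simpl; try rewrite tsubst_up_tshift; constructor; auto.
Qed.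

(** Keeping the bounding term literally of the form [tshift t] lets [constructor] recognise a
    bounded quantifier. *)
Definition ball (t : term) (A : form) : form := ∀ (#0 < tshift t -> A).
Definition bex (t : term) (A : form) : form := ∃ (#0 < tshift t /\ A).

Ltac delta := repeat constructor.

(** * Induction and comprehension inside a model *)

Section Model.

Variable M : structure.
Hypothesis HM : forall B, RCA0 B -> models M B.
(** A valuation must interpret every set index by a set; [E0] fills the indices that carry no
    parameter. *)
Variable E0 : nat -> dom M -> Prop.
Hypothesis HE0 : forall n, is_set M (E0 n).

Declare Scope dom_scope.
Delimit Scope dom_scope with dom.
Local Notation "0" := (zero M) : dom_scope.
Local Notation "1" := (one M) : dom_scope.
Local Notation "2" := (add M (one M) (one M)) : dom_scope.
Local Notation "x + y" := (add M x y) : dom_scope.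
Local Notation "x * y" := (mul M x y) : dom_scope.
Local Notation "x < y" := (lt M x y) : dom_scope.
Local Notation "x = y" := (@eq (dom M) x y) : dom_scope.
Local Notation "⟨ x , y ⟩" := ((x + y) * (x + y) + x)%dom : dom_scope.
Local Close Scope form_scope.
Local Open Scope dom_scope.

Local Infix "∷" := scons (at level 60, right associativity).
Local Notation e0 := (fun _ : nat => zero M).

Lemma Sigma01_ind A e E : Delta00 A -> (forall n, is_set M (E n)) ->
  (exists k, sat M (scons k (scons 0 e)) E A) ->
  (forall x, (exists k, sat M (scons k (scons x e)) E A) ->
     exists k, sat M (scons k (scons (x + 1) e)) E A) ->
  forall x, exists k, sat M (scons k (scons x e)) E A.
Proof.
  intros HA HE H0 HS.
  apply (HM _ (ax_Sigma01_induction _ (Sigma01_ex _ HA)) e E HE).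
  split; [| intros x Hx]; apply (sat_subst M (Ex A)).
  - destruct H0 as [k Hk]; exists k; revert Hk.
    apply sat_ext; [intros [|[|n]] | ]; reflexivity.
  - destruct (HS x Hx) as [k Hk]; exists k; revert Hk.
    apply sat_ext; [intros [|[|n]] | ]; reflexivity.
Qed.

(** Shifting all variables of [A] by one frees index 0 for a dummy existential witness, which turns
    [A] into the matrix of a Sigma01 formula. *)
Lemma Delta00_ind A e E : Delta00 A -> (forall n, is_set M (E n)) ->
  sat M (scons 0 e) E A ->
  (forall x, sat M (scons x e) E A -> sat M (scons (x + 1) e) E A) ->
  forall x, sat M (scons x e) E A.
Proof.
  intros HA HE H0 HS x.
  assert (Hsh : forall k x, sat M (scons k (scons x e)) E (subst (fun n => Var (S n)) A)
    <-> sat M (scons x e) E A) by (intros; apply sat_subst).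
  destruct (Sigma01_ind (subst (fun n => Var (S n)) A) e E) with (x := x) as [k Hk];
    auto using Delta00_subst.
  - exists 0; apply Hsh, H0.
  - intros y [k Hk]; exists k; apply Hsh, HS; apply Hsh in Hk; exact Hk.
  - apply Hsh in Hk; exact Hk.
Qed.

Lemma Delta01_comprehension A B e E : Delta00 A -> Delta00 B ->
  (forall n, is_set M (E n)) ->
  (forall x, (exists k, sat M (scons k (scons x e)) E A) <->
     (forall k, sat M (scons k (scons x e)) E B)) ->
  exists X, is_set M X /\
    forall x, X x <-> exists k, sat M (scons k (scons x e)) E A.
Proof.
  intros HA HB HE HAB.
  destruct (HM _ (ax_Delta01_comprehension _ _ (Sigma01_ex _ HA) (Pi01_all _ HB)) e E HE HAB)
    as (X & HX & H).
  exists X; split; [exact HX|].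
  intro x; rewrite (H x); apply (sat_renS M (Ex A)).
Qed.

(** * Arithmetic *)

Lemma succ_ne_zero x : x + 1 <> 0.
Proof. exact (HM _ ax_succ_ne_zero (x ∷ e0) E0 HE0). Qed.

Lemma succ_inj x y : x + 1 = y + 1 -> x = y.
Proof. exact (HM _ ax_succ_inj (x ∷ y ∷ e0) E0 HE0). Qed.

Lemma add_0_r x : x + 0 = x.
Proof. exact (HM _ ax_add_zero (x ∷ e0) E0 HE0). Qed.

Lemma add_succ_r x y : x + (y + 1) = (x + y) + 1.
Proof. exact (HM _ ax_add_succ (x ∷ y ∷ e0) E0 HE0). Qed.

Lemma mul_0_r x : x * 0 = 0.
Proof. exact (HM _ ax_mul_zero (x ∷ e0) E0 HE0). Qed.

Lemma mul_succ_r x y : x * (y + 1) = x * y + x.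
Proof. exact (HM _ ax_mul_succ (x ∷ y ∷ e0) E0 HE0). Qed.

Lemma not_lt_zero x : ~ x < 0.
Proof. exact (HM _ ax_not_lt_zero (x ∷ e0) E0 HE0). Qed.

Lemma lt_succ x y : x < y + 1 <-> x < y \/ x = y.
Proof. exact (HM _ ax_lt_succ (x ∷ y ∷ e0) E0 HE0). Qed.

Tactic Notation "induct" constr(A) constr(e) :=
  refine (Delta00_ind A e E0 ltac:(delta) HE0 _ _); cbn [sat eval scons].

Lemma add_0_l x : 0 + x = x.
Proof.
  revert x; induct (0 + #0 = #0)%form e0.
  - apply add_0_r.
  - intros x IH; rewrite add_succ_r, IH; reflexivity.
Qed.

Lemma add_assoc x y z : x + (y + z) = x + y + z.
Proof.
  revert z; induct (#1 + (#2 + #0) = #1 + #2 + #0)%form (x ∷ y ∷ e0).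
  - rewrite !add_0_r; reflexivity.
  - intros z IH; rewrite !add_succ_r, IH; reflexivity.
Qed.

Lemma add_succ_l x y : (x + 1) + y = (x + y) + 1.
Proof.
  revert y; induct ((#1 + 1) + #0 = (#1 + #0) + 1)%form (x ∷ e0).
  - rewrite !add_0_r; reflexivity.
  - intros y IH; rewrite !add_succ_r, IH; reflexivity.
Qed.

Lemma add_comm x y : x + y = y + x.
Proof.
  revert y; induct (#1 + #0 = #0 + #1)%form (x ∷ e0).
  - rewrite add_0_r, add_0_l; reflexivity.
  - intros y IH; rewrite add_succ_r, add_succ_l, IH; reflexivity.
Qed.

Lemma mul_0_l x : 0 * x = 0.
Proof.
  revert x; induct (0 * #0 = 0)%form e0.
  - apply mul_0_r.
  - intros x IH; rewrite mul_succ_r, IH; apply add_0_r.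
Qed.

Lemma mul_1_l x : 1 * x = x.
Proof.
  revert x; induct (1 * #0 = #0)%form e0.
  - apply mul_0_r.
  - intros x IH; rewrite mul_succ_r, IH; reflexivity.
Qed.

Lemma mul_add_l x y z : (x + y) * z = x * z + y * z.
Proof.
  revert z; induct ((#1 + #2) * #0 = #1 * #0 + #2 * #0)%form (x ∷ y ∷ e0).
  - rewrite !mul_0_r, add_0_r; reflexivity.
  - intros z IH; rewrite !mul_succ_r, IH.
    rewrite <- !add_assoc; f_equal; rewrite !add_assoc; f_equal; apply add_comm.
Qed.

Lemma mul_comm x y : x * y = y * x.
Proof.
  revert y; induct (#1 * #0 = #0 * #1)%form (x ∷ e0).
  - rewrite mul_0_r, mul_0_l; reflexivity.
  - intros y IH; rewrite mul_succ_r, mul_add_l, mul_1_l, IH; reflexivity.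
Qed.

Lemma mul_assoc x y z : x * (y * z) = x * y * z.
Proof.
  revert z; induct (#1 * (#2 * #0) = #1 * #2 * #0)%form (x ∷ y ∷ e0).
  - rewrite !mul_0_r; reflexivity.
  - intros z IH.
    rewrite !mul_succ_r, <- IH, mul_comm, mul_add_l, (mul_comm _ x), (mul_comm y x).
    reflexivity.
Qed.

Lemma dom_semiring :
  semi_ring_theory 0 1 (add M) (mul M) (@eq (dom M)).
Proof.
  constructor; auto using add_0_l, add_comm, add_assoc, mul_1_l, mul_0_l, mul_comm,
    mul_assoc, mul_add_l.
Qed.

Add Ring dom_ring : dom_semiring.

Lemma add_cancel_r x y z : x + z = y + z -> x = y.
Proof.
  revert z; induct (#1 + #0 = #2 + #0 -> #1 = #2)%form (x ∷ y ∷ e0).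
  - rewrite !add_0_r; auto.
  - intros z IH H; apply IH, succ_inj; rewrite <- !add_succ_r; exact H.
Qed.

(** The axioms describe [lt] only at zero and at successors; the additive form hands inequalities
    over to [ring]. From left to right, the hypothesis [x < y] is moved under the quantifier on [z],
    so that the induction formula is Sigma01. *)
Lemma lt_exists x y : x < y <-> exists z, y = x + z + 1.
Proof.
  split.
  - intro H.
    destruct (Sigma01_ind (#2 < #1 -> #1 = #2 + #0 + 1)%form (x ∷ e0) E0) with (x := y)
      as [z Hz]; cbn [sat eval scons] in *.
    + delta.
    + exact HE0.
    + exists 0; intro H'; contradict H'; apply not_lt_zero.
    + intros w [k Hk].
      assert (D : w + 1 = x + (k + 1) + 1 -> exists k, x < w + 1 -> w + 1 = x + k + 1)
        by (intro D; exists (k + 1); auto).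
      destruct (HM _ ax_lt_succ (x ∷ w ∷ e0) E0 HE0) as [D1 _]; cbn in D1.
      destruct (classic (x < w)) as [Hl|Hl].
      * apply D; rewrite (Hk Hl) at 1; ring.
      * exists 0; intro H'; destruct (D1 H') as [H1| ->]; [contradiction | ring].
    + exists z; auto.
  - intros [z ->]; revert z; induct (#1 < #1 + #0 + 1)%form (x ∷ e0).
    + apply lt_succ; right; ring.
    + intros z IH; apply lt_succ; left.
      replace (x + (z + 1)) with (x + z + 1) by ring; exact IH.
Qed.

Lemma lt_irrefl x : ~ x < x.
Proof.
  intros [z Hz]%lt_exists.
  apply (succ_ne_zero z), (add_cancel_r _ _ x); rewrite Hz at 2; ring.
Qed.

Lemma lt_trans x y z : x < y -> y < z -> x < z.
Proof.
  intros [u ->]%lt_exists [v ->]%lt_exists; apply lt_exists.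
  exists (u + v + 1); ring.
Qed.

Lemma lt_asym x y : x < y -> ~ y < x.
Proof. intros H1 H2; exact (lt_irrefl x (lt_trans _ _ _ H1 H2)). Qed.

Lemma zero_or_succ x : x = 0 \/ exists y, x = y + 1.
Proof.
  destruct (Sigma01_ind (#1 = 0 \/ #1 = #0 + 1)%form e0 E0) with (x := x) as [z Hz];
    cbn [sat eval scons] in *.
  - delta.
  - exact HE0.
  - exists 0; auto.
  - intros w _; exists w; auto.
  - destruct Hz; eauto.
Qed.

Lemma lt_total x y : x < y \/ x = y \/ y < x.
Proof.
  revert y; induct (#1 < #0 \/ #1 = #0 \/ #0 < #1)%form (x ∷ e0).
  - destruct (zero_or_succ x) as [-> | [y ->]]; auto.
    right; right; apply lt_exists; exists y; ring.
  - intros y [H | [-> | H]].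
    + left; apply lt_succ; auto.
    + left; apply lt_succ; auto.
    + right; apply lt_exists in H; destruct H as [z ->].
      destruct (zero_or_succ z) as [-> | [u ->]].
      * left; ring.
      * right; apply lt_exists; exists u; ring.
Qed.

(** The language has only the strict order, so weak inequality is written [y < x + 1] from here
    on. *)
Lemma not_lt x y : ~ x < y <-> y < x + 1.
Proof.
  rewrite lt_succ; split.
  - intro H; destruct (lt_total x y) as [?|[->|?]]; tauto.
  - intros [H | ->]; [apply lt_asym; exact H | apply lt_irrefl].
Qed.

Lemma le_exists x y : x < y + 1 <-> exists z, y = x + z.
Proof.
  rewrite lt_exists; split; intros [z H]; exists z.
  - apply succ_inj, H.
  - rewrite H; reflexivity.
Qed.

Lemma le_lt_trans x y z : x < y + 1 -> y < z -> x < z.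
Proof. intros [H | ->]%lt_succ H'; eauto using lt_trans. Qed.

Lemma lt_le_trans x y z : x < y -> y < z + 1 -> x < z.
Proof. intros H [H' | ->]%lt_succ; eauto using lt_trans. Qed.

Lemma succ_le x y : x < y <-> x + 1 < y + 1.
Proof.
  rewrite le_exists, lt_exists; split; intros [z ->]; exists z; ring.
Qed.

(** If no least element existed, induction on [y] would show that no [z < y] satisfies [A]; with its
    bounded quantifier this statement is still Delta00. *)
Lemma Delta00_least A e E : Delta00 A -> (forall n, is_set M (E n)) ->
  (exists x, sat M (x ∷ e) E A) ->
  exists x, sat M (x ∷ e) E A /\ forall z, z < x -> ~ sat M (z ∷ e) E A.
Proof.
  intros HA HE [x Hx]; apply NNPP; intro Hno.
  (* [σ] keeps the tested variable at index 0 and skips index 1, which is taken by the bound [y]. *)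
  set (σ := scons #0%term (fun n => Var (S (S n)))).
  assert (Hσ : forall z y, sat M (z ∷ y ∷ e) E (subst σ A) <-> sat M (z ∷ e) E A).
  { intros z y; rewrite sat_subst; apply sat_ext; [intros [|n]|]; reflexivity. }
  assert (Hall : forall y z, z < y -> ~ sat M (z ∷ e) E A).
  { assert (H : forall y, sat M (y ∷ e) E (ball #0 (Not (subst σ A)))).
    { apply Delta00_ind; auto.
      - constructor; constructor; apply Delta00_subst, HA.
      - intros z Hz; contradict Hz; apply not_lt_zero.
      - intros y IH z Hz; cbn in Hz |- *; rewrite Hσ.
        assert (IH' : forall z, z < y -> ~ sat M (z ∷ e) E A)
          by (intros w Hw; rewrite <- (Hσ w y); exact (IH w Hw)).
        apply lt_succ in Hz; destruct Hz as [Hz | ->]; [auto|].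
        intro Hy; apply Hno; exists y; auto. }
    intros y z Hz; rewrite <- (Hσ z y); exact (H y z Hz). }
  apply (Hall (x + 1) x); [apply lt_succ; auto | exact Hx].
Qed.

(** * Pairing codes and definable relations *)

Lemma le_mul_r x y : 0 < y -> x < x * y + 1.
Proof.
  intros [z ->]%lt_exists; apply le_exists; exists (x * z); ring.
Qed.

Lemma lt_0_succ x : 0 < x + 1.
Proof. apply lt_exists; exists x; ring. Qed.

Lemma le_square x : x < x * x + 1.
Proof.
  destruct (zero_or_succ x) as [-> | [y ->]].
  - apply le_exists; exists 0; ring.
  - apply le_mul_r, lt_0_succ.
Qed.

Lemma le_pair_l x y : x < ⟨x, y⟩ + 1.
Proof. apply le_exists; exists ((x + y) * (x + y)); ring. Qed.

Lemma le_pair_r x y : y < ⟨x, y⟩ + 1.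
Proof.
  destruct (proj1 (le_exists _ _) (le_square (x + y))) as [z Hz].
  apply le_exists; exists (x + z + x); rewrite Hz; ring.
Qed.

(** With [s = x + y], the summand [x] is at most [s], too small to reach from the square of [s] to
    that of [s + 1]. Codes are therefore ordered first by the sum of their coordinates. *)
Lemma pair_lt x y x' y' : x + y < x' + y' -> ⟨x, y⟩ < ⟨x', y'⟩.
Proof.
  intros [z Hz]%lt_exists; rewrite Hz; apply lt_exists.
  exists (y + 2 * (x + y) * z + (x + y) + z * z + 2 * z + x'); ring.
Qed.

Lemma pair_inj x y x' y' : ⟨x, y⟩ = ⟨x', y'⟩ -> x = x' /\ y = y'.
Proof.
  intro H.
  assert (Hs : x + y = x' + y').
  { destruct (lt_total (x + y) (x' + y')) as [Hl | [Hl | Hl]]; [| exact Hl |];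
      apply pair_lt in Hl; rewrite H in Hl; contradict Hl; apply lt_irrefl. }
  rewrite Hs in H.
  assert (Hx : x = x').
  { apply (add_cancel_r _ _ ((x' + y') * (x' + y'))).
    rewrite add_comm, H; ring. }
  split; [exact Hx|]; subst x'.
  apply (add_cancel_r _ _ x); rewrite (add_comm y), Hs; ring.
Qed.

(* In [A] and [B] the variables #0, #1, #2, #3 stand for y, x, the unbounded
   witness and the code of (x, y); parameters start at #4. *)
Lemma relation_comprehension A B e E : Delta00 A -> Delta00 B ->
  (forall n, is_set M (E n)) ->
  (forall x y, (exists k, sat M (y ∷ x ∷ k ∷ ⟨x, y⟩ ∷ e) E A) <->
     (forall k, sat M (y ∷ x ∷ k ∷ ⟨x, y⟩ ∷ e) E B)) ->
  exists R, is_set M R /\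
    (forall n, R n -> exists x y, n = ⟨x, y⟩) /\
    forall x y, R ⟨x, y⟩ <-> exists k, sat M (y ∷ x ∷ k ∷ ⟨x, y⟩ ∷ e) E A.
Proof.
  intros HA HB HE HAB.
  (* Both coordinates are at most the code, so decoding costs only bounded quantifiers; [#1] and
     then [#2] denote the code. *)
  set (code A := bex (#1 + 1) (bex (#2 + 1) (And (Eq #3 (pair #1 #0)) A))).
  assert (Hcode : forall A k n, sat M (k ∷ n ∷ e) E (code A) <->
    exists x y, n = ⟨x, y⟩ /\ sat M (y ∷ x ∷ k ∷ n ∷ e) E A).
  { intros C k n; split.
    - intros (x & _ & y & _ & Hn & H); exists x, y; split; [exact Hn | exact H].
    - intros (x & y & Hn & H); exists x; split; [|exists y; split; [|split; assumption]];
        cbn; rewrite Hn; [apply le_pair_l | apply le_pair_r]. }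
  destruct (Delta01_comprehension (code A) (code B) e E) as (R & HR & H).
  - repeat constructor; assumption.
  - repeat constructor; assumption.
  - exact HE.
  - intro n; split.
    + intros [k Hk]; apply Hcode in Hk; destruct Hk as (x & y & -> & Hk).
      intro k'; apply Hcode; exists x, y; split; [reflexivity|].
      apply HAB; exists k; exact Hk.
    (* The coordinates are read off at witness 0; injectivity of the pairing shows that every other
       witness yields the same ones. *)
    + intro Hall; destruct (proj1 (Hcode B 0 n) (Hall 0)) as (x & y & -> & _).
      destruct (proj2 (HAB x y)) as [k Hk].
      * intro k; destruct (proj1 (Hcode B k _) (Hall k)) as (x' & y' & Hn & Hk).
        destruct (pair_inj _ _ _ _ Hn); subst x' y'; exact Hk.
      * exists k; apply Hcode; exists x, y; auto.
  - exists R; split; [exact HR|]; split.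
    + intros n Hn; apply H in Hn; destruct Hn as [k Hk]; apply Hcode in Hk.
      destruct Hk as (x & y & Hn & _); eauto.
    + intros x y; rewrite H; split; intros [k Hk]; exists k.
      * apply Hcode in Hk; destruct Hk as (x' & y' & Hn & Hk).
        destruct (pair_inj _ _ _ _ Hn); subst x' y'; exact Hk.
      * apply Hcode; exists x, y; auto.
Qed.

(** * The pigeonhole principle *)

Definition divides x y := exists k, y = x * k.

(* Bounding the quotient keeps divisibility [Delta00]; it loses nothing when
   the divisor is positive. *)
Definition dvd (s t : term) : form := bex (t + 1) (Eq (tshift t) (tshift s * #0)).

Lemma bounded_divides x y : 0 < x ->
  (exists k, k < y + 1 /\ y = x * k) <-> divides x y.
Proof.
  intro Hx; split.
  - intros (k & _ & H); exists k; exact H.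
  - intros [k ->]; exists k; split; [|reflexivity].
    rewrite mul_comm; apply le_mul_r, Hx.
Qed.

Lemma divides_mul_r x y z : divides x y -> divides x (y * z).
Proof. intros [k ->]; exists (k * z); ring. Qed.

Lemma divides_mul_l x y z : divides x z -> divides x (y * z).
Proof. intros [k ->]; exists (y * k); ring. Qed.

Lemma divides_refl x : divides x x.
Proof. exists 1; ring. Qed.

(** In the absence of subtraction the quotients [k] and [l] are compared: [k < l] forces [z = 0],
    and otherwise their difference is the quotient of [z]. *)
Lemma divides_add_cancel x y z : divides x (y + z) -> divides x y -> divides x z.
Proof.
  intros [k Hk] [l ->].
  destruct (lt_total k l) as [H | [-> | H]].
  - apply lt_exists in H; destruct H as [u ->].
    assert (H : z + x * (u + 1) + x * k = 0 + x * k) 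
      by (transitivity (x * (k + u + 1) + z); [ring | rewrite Hk; ring]).
    apply add_cancel_r in H.
    destruct (zero_or_succ z) as [-> | [w ->]]; [exists 0; ring|].
    exfalso; apply (succ_ne_zero (w + x * (u + 1))); rewrite <- H; ring.
  - exists 0; apply (add_cancel_r _ _ (x * l)); rewrite mul_0_r, add_0_l, add_comm; exact Hk.
  - apply lt_exists in H; destruct H as [u ->].
    exists (u + 1); apply (add_cancel_r _ _ (x * l)).
    rewrite add_comm, Hk; ring.
Qed.

(** Sigma01 induction on [b] multiplies in one factor at a time, so no code for the sequence of
    factors is needed. Positivity is carried along to keep the multiple from collapsing to 0. *)
Lemma common_multiple s t b :
  exists a, 0 < a /\ forall i, i < b -> divides (s * i + t + 1) a.
Proof.
  destruct (Sigma01_ind (0 < #0 /\ ball #1 (dvd (#3 * #0 + #4 + 1) #1))%form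
    (s ∷ t ∷ e0) E0) with (x := b) as [a [Ha H]]; cbn [sat eval scons] in *.
  - delta.
  - exact HE0.
  - exists 1; split.
    + change (0 < 1); apply lt_exists; exists 0; ring.
    + intros i Hi; contradict Hi; apply not_lt_zero.
  - intros c [a [Ha H]].
    exists (a * (s * c + t + 1)).
    cbn in Ha, H |- *; split.
    + apply lt_exists in Ha; destruct Ha as [u ->]; apply lt_exists.
      exists (u * (s * c + t + 1) + (s * c + t)); ring.
    + intros i Hi; apply bounded_divides; [apply lt_0_succ|].
      apply lt_succ in Hi; destruct Hi as [Hi | ->].
      * apply divides_mul_r, (bounded_divides _ _ (lt_0_succ _)), H, Hi.
      * apply divides_mul_l, divides_refl.
  - exists a; split; [exact Ha|].
    intros i Hi; apply (bounded_divides _ _ (lt_0_succ _)), H, Hi.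
Qed.

(* Modulo q = mj + m + 1 the number m(j + 1) is -1, so every divisor of m,
   and hence the difference dm of two such moduli, is invertible. *)
Lemma divides_difference m d j z : divides d m ->
  divides (m * j + m + 1) (d * m * z) -> divides (m * j + m + 1) z.
Proof.
  intros [e He] H.
  set (r := m * j + m) in *.
  apply divides_add_cancel with (y := (r + 1) * (r * z) + 0).
  (* Since [d * e = m] and [m * (j + 1) = r], the first summand equals [r * r * z]; the multiple
     [(r + 1) * z] is added instead of subtracting. *)
  - replace ((r + 1) * (r * z) + 0 + z) with (d * m * z * (e * (j + 1) * (j + 1)) + (r + 1) * z).
    + destruct (divides_mul_r _ _ (e * (j + 1) * (j + 1)) H) as [k ->].
      exists (k + z); ring.
    + transitivity (r * r * z + (r + 1) * z); [|ring].
      f_equal; unfold r; rewrite He; ring.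
  - exists (r * z); ring.
Qed.

(** These are the moduli of Gödel's beta function. Two of them differ by [(d + 1) * m], where
    [d + 1] is the distance of the indices and divides [m], so the difference can be cancelled. *)
Lemma moduli_coprime m b i j z :
  (forall d, d < b -> divides (d + 1) m) -> i < b -> j < b -> i <> j ->
  divides (m * j + m + 1) ((m * i + m + 1) * z) -> divides (m * j + m + 1) z.
Proof.
  intros Hm Hi Hj Hij H.
  assert (Hd : forall k l d, l = k + d + 1 -> l < b -> divides (d + 1) m).
  { intros k l d -> Hl; apply Hm; apply lt_trans with (2 := Hl), lt_exists.
    exists k; ring. }
  destruct (lt_total i j) as [Hl | [Hl | Hl]]; [| contradiction |];
    apply lt_exists in Hl; destruct Hl as [d Hl];
    apply (divides_difference m (d + 1)); eauto.
  - apply divides_add_cancel with (2 := H).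
    exists z; rewrite Hl; ring.
  - apply divides_add_cancel with (y := (m * j + m + 1) * z);
      [|exists z; reflexivity].
    replace ((m * j + m + 1) * z + (d + 1) * m * z) with ((m * i + m + 1) * z);
      [exact H | rewrite Hl; ring].
Qed.

Definition is_function F :=
  forall n, exists a, F ⟨n, a⟩ /\ forall b, F ⟨n, b⟩ -> b = a.

Lemma function_unique F n a b : is_function F -> F ⟨n, a⟩ -> F ⟨n, b⟩ -> a = b.
Proof. intros HF Ha Hb; destruct (HF n) as (c & _ & H); rewrite (H a Ha); symmetry; auto. Qed.

(* If all values lay below b, the product of the moduli indexed by
   f(0), ..., f(n-1) would be a divisor exceeding n of a fixed number. *)
Lemma injective_unbounded F b : is_set M F -> is_function F ->
  (forall n m a, F ⟨n, a⟩ -> F ⟨m, a⟩ -> n = m) ->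
  exists n a, F ⟨n, a⟩ /\ ~ a < b.
Proof.
  intros HF Hfun Hinj; apply NNPP; intro Hno.
  assert (Hb : forall n a, F ⟨n, a⟩ -> a < b)
    by (intros n a Ha; apply NNPP; intro; apply Hno; eauto).
  clear Hno.
  (* [m] is a multiple of 1, ..., [b], which makes the moduli [q i] coprime; [A] below is a common
     multiple of them. *)
  destruct (common_multiple 1 0 b) as (m & Hm0 & Hm).
  assert (Hm' : forall d, d < b -> divides (d + 1) m).
  { intros d Hd; replace (d + 1) with (1 * d + 0 + 1) by ring; auto. }
  destruct (common_multiple m m b) as (A & HA0 & HA).
  set (q i := m * i + m + 1) in *.
  assert (Hq : forall i, 0 < q i) by (intro; apply lt_0_succ).
  (* The invariant for the partial product [c] after [n] values: it divides [A], exceeds [n], and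
     can be cancelled modulo each [q i] whose index has not yet occurred as a value. Restricting to
     [z] at most [A] makes this Delta00, as [φ] records. *)
  set (ψ c n := 0 < c /\ divides c A /\ n < c /\ forall i, i < b ->
    (forall z, z < A + 1 -> divides (q i) (c * z) -> divides (q i) z) \/
    exists k, k < n /\ F ⟨k, i⟩).
  pose (φ := (0 < #0 /\ dvd #0 #2 /\ #1 < #0 /\
    ball #3 (ball (#3 + 1) (dvd (#6 * #1 + #6 + 1) (#2 * #0) ->
                            dvd (#6 * #1 + #6 + 1) #0)
             \/ bex #2 (pair #0 #1 ∈ 0)))%form).
  assert (Hφ : forall c n, sat M (c ∷ n ∷ A ∷ b ∷ m ∷ e0) (F ∷ E0) φ <-> ψ c n).
  { intros c n; split; intros (Hc0 & Hc & Hn & H).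
    - split; [exact Hc0|]; split; [exact (proj1 (bounded_divides _ _ Hc0) Hc)|].
      split; [exact Hn|]; intros i Hi; destruct (H i Hi) as [H' | H']; [left | right; exact H'].
      intros z Hz Hd; apply (bounded_divides _ z (Hq i)), (H' z Hz).
      apply (bounded_divides _ (c * z) (Hq i)), Hd.
    - split; [exact Hc0|]; split; [exact (proj2 (bounded_divides _ _ Hc0) Hc)|].
      split; [exact Hn|]; intros i Hi; destruct (H i Hi) as [H' | H']; [left | right; exact H'].
      intros z Hz Hd; apply (bounded_divides _ z (Hq i)), (H' z Hz).
      apply (bounded_divides _ (c * z) (Hq i)), Hd. }
  assert (HP : forall n, exists c, sat M (c ∷ n ∷ A ∷ b ∷ m ∷ e0) (F ∷ E0) φ).
  { apply Sigma01_ind.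
    - delta.
    - intros [|n]; [exact HF | apply HE0].
    - exists 1; apply Hφ; unfold ψ.
      assert (H01 : 0 < 1) by (apply lt_exists; exists 0; ring).
      split; [exact H01|]; split; [exists A; ring|]; split; [exact H01|].
      intros i _; left; intros z _; rewrite mul_1_l; auto.
    - intros n [c Hc]; apply Hφ in Hc; destruct Hc as (Hc0 & [k Hk] & Hnc & Hc).
      destruct (Hfun n) as (i & Hi & _).
      destruct (HA i (Hb n i Hi)) as [u Hu]; fold (q i) in Hu.
      (* By injectivity the value [i] is new, so [c] cancels modulo [q i] in [A = c * k]; hence
         [c * q i] still divides [A]. *)
      assert (Hdk : divides (q i) k).
      { destruct (Hc i (Hb n i Hi)) as [H | (n' & Hn' & H)].
        - apply H; [|exists u; rewrite <- Hk; exact Hu].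
          rewrite Hk, mul_comm; apply le_mul_r, Hc0.
        - rewrite (Hinj _ _ _ H Hi) in Hn'; contradict Hn'; apply lt_irrefl. }
      destruct Hdk as [l ->].
      exists (c * q i); apply Hφ.
      apply lt_exists in Hc0; destruct Hc0 as [c' ->].
      apply lt_exists in Hm0; destruct Hm0 as [m' ->].
      split; [|split; [|split]].
      + apply lt_exists; exists (c' * q i + (0 + m' + 1) * i + (0 + m' + 1)); unfold q; ring.
      + exists l; rewrite Hk; ring.
      (* As [m] is positive, [q i] is at least 2, and [c * q i] is at least [c + 1], which exceeds
         [n + 1]. *)
      + apply lt_exists in Hnc; destruct Hnc as [v Hv]; apply lt_exists.
        exists (v + (0 + c' + 1) * (0 + m' + 1) * i + (0 + c' + 1) * m' + c').
        unfold q; replace (n + 1 + (v + (0 + c' + 1) * (0 + m' + 1) * i + (0 + c' + 1) * m' + c') + 1)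
          with ((n + v + 1) + (0 + c' + 1) * (0 + m' + 1) * i + (0 + c' + 1) * m' + (c' + 1)) by ring.
        rewrite <- Hv; ring.
      + intros j Hj; destruct (classic (i = j)) as [<- | Hij].
        * right; exists n; split; [apply lt_succ; auto | exact Hi].
        * destruct (Hc j Hj) as [H | (n' & Hn' & H)].
          -- left; intros z Hz Hd; apply (H z Hz).
             apply (moduli_coprime _ b i j _ Hm' (Hb n i Hi) Hj Hij).
             fold (q i) (q j); rewrite mul_assoc, (mul_comm (q i)); exact Hd.
          -- right; exists n'; split; [apply lt_succ; auto | exact H]. }
  (* After [A] steps the divisor [c] of the positive number [A] would exceed [A]. *)
  destruct (HP A) as [c Hc]; apply Hφ in Hc; destruct Hc as (_ & [k Hk] & HAc & _).
  apply (lt_irrefl A); apply lt_le_trans with (1 := HAc).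
  destruct (zero_or_succ k) as [-> | [k' ->]].
  - rewrite Hk, mul_0_r in HA0; contradict HA0; apply lt_irrefl.
  - rewrite Hk; apply le_mul_r, lt_0_succ.
Qed.

(** * Stable colorings, tournaments and linear orders *)

Definition unbounded S := forall b, exists x, b < x /\ S x.

(** [P] sends [x] to the least element of [S] that is at least [x]. Minimality speaks only of
    smaller numbers, so one Delta00 formula serves as both the Sigma01 and the Pi01 definition. *)
Lemma next_element S : is_set M S -> unbounded S ->
  exists P, is_set M P /\ is_function P /\
    forall x s, P ⟨x, s⟩ -> S s /\ x < s + 1.
Proof.
  intros HS Hinf.
  pose (A := (#0 ∈ 0 /\ #1 < #0 + 1 /\ ball #0 (#0 ∈ 0 -> ~ (#2 < #0 + 1)))%form).
  destruct (relation_comprehension A A e0 (S ∷ E0)) as (P & HP & _ & H).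
  - delta.
  - delta.
  - intros [|n]; [exact HS | apply HE0].
  - intros x y; split; [intros [k Hk] k'; exact Hk | intro Hk; exists 0; exact (Hk 0)].
  - assert (HPs : forall x s, P ⟨x, s⟩ <->
      S s /\ x < s + 1 /\ forall z, z < s -> S z -> ~ x < z + 1).
    { intros x s; rewrite H; split; [intros [k Hk]; exact Hk | intro Hk; exists 0; exact Hk]. }
    clear H; exists P; split; [exact HP|]; split.
    + intro x.
      destruct (Delta00_least (#0 ∈ 0 /\ #1 < #0 + 1)%form (x ∷ e0) (S ∷ E0))
        as (s & [Hs Hxs] & Hmin).
      * delta.
      * intros [|n]; [exact HS | apply HE0].
      * destruct (Hinf x) as (s & Hxs & Hs); exists s; split; [exact Hs|].
        apply lt_succ; left; exact Hxs.
      * assert (Hmin' : forall z, z < s -> S z -> ~ x < z + 1)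
          by (intros z Hz Hz1 Hz2; apply (Hmin z Hz); split; assumption).
        exists s; split; [apply HPs; auto|].
        intros t Ht; apply HPs in Ht; destruct Ht as (Ht & Hxt & Hmint).
        destruct (lt_total s t) as [Hl | [Hl | Hl]]; [| symmetry; exact Hl |].
        -- destruct (Hmint s Hl Hs Hxs).
        -- destruct (Hmin' t Hl Ht Hxt).
    + intros x s Hs; apply HPs in Hs; tauto.
Qed.

(** The intermediate value exists and is unique, so it may be quantified existentially or
    universally; this makes the composition Delta01. *)
Lemma function_comp F P : is_set M F -> is_set M P -> is_function F -> is_function P ->
  exists K, is_set M K /\ is_function K /\
    forall n s, K ⟨n, s⟩ <-> exists a, F ⟨n, a⟩ /\ P ⟨a, s⟩.
Proof.
  intros HF HP HFf HPf.
  destruct (relation_comprehension (pair #1 #2 ∈ 0 /\ pair #2 #0 ∈ 1)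
    (pair #1 #2 ∈ 0 -> pair #2 #0 ∈ 1) e0 (F ∷ P ∷ E0)) as (K & HK & _ & H).
  - delta.
  - delta.
  - intros [|[|n]]; [exact HF | exact HP | apply HE0].
  - intros x y; split.
    + intros [a [Ha Hy]] a' Ha'; cbn in Ha, Hy, Ha' |- *.
      rewrite (function_unique _ _ _ _ HFf Ha' Ha); exact Hy.
    + intro Hall; destruct (HFf x) as (a & Ha & _); exists a; split; [exact Ha|].
      exact (Hall a Ha).
  - exists K; split; [exact HK|]; split; [|exact H].
    intro n; destruct (HFf n) as (a & Ha & _); destruct (HPf a) as (s & Hs & _).
    exists s; split; [apply H; exists a; split; assumption|].
    intros t Ht; apply H in Ht; destruct Ht as (a' & Ha' & Ht); cbn in Ha', Ht.
    rewrite (function_unique _ _ _ _ HFf Ha' Ha) in Ht.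
    exact (function_unique _ _ _ _ HPf Ht Hs).
Qed.

(* H consists of the values exceeding all earlier ones. *)
Lemma records K : is_set M K -> is_function K ->
  (forall b, exists n a, K ⟨n, a⟩ /\ ~ a < b) ->
  exists H, is_set M H /\ unbounded H /\
    forall x y, H x -> H y -> x < y -> exists n m, n < m /\ K ⟨n, x⟩ /\ K ⟨m, y⟩.
Proof.
  intros HK Hfun Hub.
  set (below n s := exists t, t < s /\ K ⟨n, t⟩).
  assert (Hbelow : forall n a s, K ⟨n, a⟩ -> below n s <-> a < s).
  { intros n a s Ha; split; [|intro; exists a; auto].
    intros (t & Ht & Hnt); rewrite (function_unique _ _ _ _ Hfun Ha Hnt); exact Ht. }
  assert (HKE : forall n, is_set M ((K ∷ E0) n))
    by (intros [|n]; [exact HK | apply HE0]).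
  assert (Hfirst : forall s, exists n, ~ below n s /\ forall m, m < n -> below m s).
  { intro s.
    destruct (Delta00_least (~ bex #1 (pair #1 #0 ∈ 0))%form (s ∷ e0) (K ∷ E0))
      as (n & Hn & Hmin).
    - delta.
    - exact HKE.
    - destruct (Hub s) as (n & a & Hna & Ha); exists n.
      intro Hn; apply Ha; exact (proj1 (Hbelow _ _ _ Hna) Hn).
    - exists n; split; [exact Hn|].
      intros m Hm; exact (NNPP _ (Hmin m Hm)). }
  assert (Huniq : forall s n m, ~ below n s -> (forall k, k < n -> below k s) ->
    ~ below m s -> (forall k, k < m -> below k s) -> n = m).
  { intros s n m Hn Hn' Hm Hm'.
    destruct (lt_total n m) as [Hl | [Hl | Hl]]; [| exact Hl |].
    - destruct (Hn (Hm' n Hl)).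
    - destruct (Hm (Hn' m Hl)). }
  assert (Hself : forall n s, K ⟨n, s⟩ -> ~ below n s)
    by (intros n s Hs; rewrite (Hbelow _ _ _ Hs); apply lt_irrefl).
  (* A record [s] is the value at the first index whose value is at least [s]. That index is unique,
     so it too may be quantified either way. *)
  destruct (Delta01_comprehension
    (pair #0 #1 ∈ 0 /\ ball #0 (bex #2 (pair #1 #0 ∈ 0)))
    (~ bex #1 (pair #1 #0 ∈ 0) /\ ball #0 (bex #2 (pair #1 #0 ∈ 0)) -> pair #0 #1 ∈ 0)
    e0 (K ∷ E0)) as (H & HH & HHs).
  - delta.
  - delta.
  - exact HKE.
  - intro s; split.
    + intros [n [Hn Hn']] m [Hm Hm'].
      assert (E : m = n) by (apply (Huniq s); auto; exact (Hself n s Hn)).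
      rewrite E; exact Hn.
    + intro Hall; destruct (Hfirst s) as (n & Hn & Hn'); exists n.
      split; [apply Hall; split; assumption | exact Hn'].
  - assert (HHs' : forall s, H s <-> exists n, K ⟨n, s⟩ /\ forall m, m < n -> below m s)
      by exact HHs.
    exists H; split; [exact HH|]; split.
    (* The first value exceeding [b] is a record, because all earlier values are at most [b]. *)
    + intro b; destruct (Hfirst (b + 1)) as (n & Hn & Hn').
      destruct (Hfun n) as (a & Ha & _).
      assert (Hba : b < a).
      { rewrite (Hbelow _ _ _ Ha), not_lt in Hn; apply succ_le; exact Hn. }
      exists a; split; [exact Hba|]; apply HHs'; exists n; split; [exact Ha|].
      intros m Hm; destruct (Hn' m Hm) as (t & Ht & Hmt); exists t; split; [|exact Hmt].
      exact (le_lt_trans _ _ _ Ht Hba).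
    + intros x y Hx Hy Hxy; apply HHs' in Hx, Hy.
      destruct Hx as (n & Hn & Hn'), Hy as (m & Hm & Hm').
      exists n, m; split; [|split; assumption].
      destruct (lt_total n m) as [Hl | [-> | Hl]]; [exact Hl | exfalso | exfalso].
      * rewrite (function_unique _ _ _ _ Hfun Hn Hm) in Hxy; exact (lt_irrefl _ Hxy).
      * apply (lt_asym _ _ Hxy), (Hbelow _ _ _ Hm), Hn', Hl.
Qed.

Definition stable_rel R := forall x, exists y,
  (forall z, y < z -> R ⟨x, z⟩) \/ (forall z, y < z -> R ⟨z, x⟩).

(* Pulling the transitive tournament on S back along the next-element function
   replaces an enumeration of S; points with the same image are ordered as
   numbers. *)
Lemma pullback_order T S P :
  is_set M T -> is_set M P -> is_function P ->
  (forall x s, P ⟨x, s⟩ -> S s /\ x < s + 1) ->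
  (forall x, ~ T ⟨x, x⟩) ->
  (forall x y, ~ x = y -> (T ⟨x, y⟩ /\ ~ T ⟨y, x⟩) \/ (T ⟨y, x⟩ /\ ~ T ⟨x, y⟩)) ->
  stable_rel T ->
  (forall x y z, S x -> S y -> S z -> T ⟨x, y⟩ -> T ⟨y, z⟩ -> T ⟨x, z⟩) ->
  exists L, is_set M L /\
    ((forall n, L n -> exists x y, n = ⟨x, y⟩) /\
     (forall x, ~ L ⟨x, x⟩) /\
     (forall x y z, L ⟨x, y⟩ -> L ⟨y, z⟩ -> L ⟨x, z⟩) /\
     (forall x y, L ⟨x, y⟩ \/ x = y \/ L ⟨y, x⟩)) /\
    stable_rel L /\
    forall x y s t, P ⟨x, s⟩ -> P ⟨y, t⟩ -> L ⟨x, y⟩ -> T ⟨s, t⟩ \/ s = t.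
Proof.
  intros HT HP Hfun HPs Hirr Htot Hst Htr.
  (* The unbounded variable [k] serves as a common bound for the images [s] and [t] under [P];
     below, [s + t + 1] is large enough. *)
  destruct (relation_comprehension
    (bex #2 (bex #3 (pair #3 #1 ∈ 1 /\ pair #2 #0 ∈ 1 /\
       (pair #1 #0 ∈ 0 \/ (#1 = #0 /\ #3 < #2)))))
    (ball #2 (ball #3 (pair #3 #1 ∈ 1 -> pair #2 #0 ∈ 1 ->
       pair #1 #0 ∈ 0 \/ (#1 = #0 /\ #3 < #2))))
    e0 (T ∷ P ∷ E0)) as (L & HL & HLrel & H).
  - delta.
  - delta.
  - intros [|[|n]]; [exact HT | exact HP | apply HE0].
  - intros x y; destruct (Hfun x) as (s & Hs & _), (Hfun y) as (t & Ht & _).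
    split.
    + intros (k & s' & _ & t' & _ & Hs' & Ht' & Hk) k' s'' _ t'' _ Hs'' Ht''.
      cbn in Hs', Ht', Hk, Hs'', Ht'' |- *.
      rewrite (function_unique _ _ _ _ Hfun Hs'' Hs'), (function_unique _ _ _ _ Hfun Ht'' Ht').
      exact Hk.
    + intro Hall.
      assert (Hsk : s < s + t + 1) by (apply le_exists; exists t; reflexivity).
      assert (Htk : t < s + t + 1) by (apply le_exists; exists s; ring).
      exists (s + t + 1), s; split; [exact Hsk|].
      exists t; split; [exact Htk|]; split; [exact Hs|]; split; [exact Ht|].
      exact (Hall (s + t + 1) s Hsk t Htk Hs Ht).
  - assert (HLT : forall x y s t, P ⟨x, s⟩ -> P ⟨y, t⟩ ->
      L ⟨x, y⟩ <-> T ⟨s, t⟩ \/ (s = t /\ x < y)).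
    { intros x y s t Hs Ht; rewrite H; split.
      - intros (k & s' & _ & t' & _ & Hs' & Ht' & Hk); cbn in Hs', Ht', Hk.
        rewrite (function_unique _ _ _ _ Hfun Hs Hs'), (function_unique _ _ _ _ Hfun Ht Ht').
        exact Hk.
      - intro Hk; exists (s + t + 1), s; split; [apply le_exists; exists t; reflexivity|].
        exists t; split; [apply le_exists; exists s; cbn; ring|].
        split; [exact Hs|]; split; [exact Ht | exact Hk]. }
    clear H; exists L; split; [exact HL|]; split; [split; [exact HLrel|]; split; [|split]|split].
    + intros x; destruct (Hfun x) as (s & Hs & _); rewrite (HLT _ _ _ _ Hs Hs).
      intros [Hx | [_ Hx]]; [exact (Hirr s Hx) | exact (lt_irrefl x Hx)].
    + intros x y z; destruct (Hfun x) as (s & Hs & _), (Hfun y) as (t & Ht & _),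
        (Hfun z) as (u & Hu & _).
      rewrite (HLT _ _ _ _ Hs Ht), (HLT _ _ _ _ Ht Hu), (HLT _ _ _ _ Hs Hu).
      intros [H1 | [-> H1]] [H2 | [<- H2]]; auto.
      * left; apply (Htr s t u); auto; eapply HPs; eassumption.
      * right; split; [reflexivity | exact (lt_trans _ _ _ H1 H2)].
    + intros x y; destruct (Hfun x) as (s & Hs & _), (Hfun y) as (t & Ht & _).
      rewrite (HLT _ _ _ _ Hs Ht), (HLT _ _ _ _ Ht Hs).
      destruct (classic (s = t)) as [-> | Hne].
      * destruct (lt_total x y) as [Hl | [Hl | Hl]]; auto.
      * destruct (Htot s t Hne) as [[Hl _] | [Hl _]]; auto.
    + intro x; destruct (Hfun x) as (s & Hs & _); destruct (Hst s) as (y & Hy).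
      (* The next-element map never decreases its argument, so images of far points stay beyond the
         stability bound of [s]. *)
      assert (Hfar : forall z t, y + s < z -> P ⟨z, t⟩ -> y < t).
      { intros z t Hz Ht; apply HPs in Ht; destruct Ht as [_ Ht].
        apply lt_le_trans with (2 := Ht).
        apply le_lt_trans with (2 := Hz), le_exists; exists s; reflexivity. }
      exists (y + s); destruct Hy as [Hy | Hy]; [left | right]; intros z Hz;
        destruct (Hfun z) as (t & Ht & _).
      * rewrite (HLT _ _ _ _ Hs Ht); left; apply Hy, (Hfar z); assumption.
      * rewrite (HLT _ _ _ _ Ht Hs); left; apply Hy, (Hfar z); assumption.
    + intros x y s t Hs Ht HL'; apply (HLT _ _ _ _ Hs Ht) in HL'; tauto.
Qed.

Definition coloring_rel C := forall x y, x < y ->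
  exists i, i < 2 /\ C ⟨⟨x, y⟩, i⟩ /\ forall j, C ⟨⟨x, y⟩, j⟩ -> j = i.

Definition stable_coloring_rel C := forall n, exists i, i < 2 /\
  exists b, forall y, b < y -> n < y -> C ⟨⟨n, y⟩, i⟩.

Lemma lt_two i : i < 2 <-> i = 0 \/ i = 1.
Proof.
  rewrite lt_succ; replace 1 with (0 + 1) at 1 by ring; rewrite lt_succ.
  split; [|tauto].
  intros [[H | H] | H]; [destruct (not_lt_zero _ H) | |]; auto.
Qed.

Lemma coloring_tournament C : is_set M C -> coloring_rel C -> stable_coloring_rel C ->
  exists T, is_set M T /\
    ((forall n, T n -> exists x y, n = ⟨x, y⟩) /\
     (forall x, ~ T ⟨x, x⟩) /\
     (forall x y, ~ x = y ->
        (T ⟨x, y⟩ /\ ~ T ⟨y, x⟩) \/ (T ⟨y, x⟩ /\ ~ T ⟨x, y⟩))) /\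
    stable_rel T /\
    forall x y, x < y ->
      (T ⟨x, y⟩ -> C ⟨⟨x, y⟩, 1⟩) /\ (T ⟨y, x⟩ -> C ⟨⟨x, y⟩, 0⟩).
Proof.
  intros HC Hcol Hst.
  pose (A := ((#1 < #0 /\ pair (pair #1 #0) 1 ∈ 0) \/
              (#0 < #1 /\ pair (pair #0 #1) 0 ∈ 0))%form).
  destruct (relation_comprehension A A e0 (C ∷ E0)) as (T & HT & HTrel & H).
  - delta.
  - delta.
  - intros [|n]; [exact HC | apply HE0].
  - intros x y; split; [intros [k Hk] k'; exact Hk | intro Hk; exists 0; exact (Hk 0)].
  - assert (Hup : forall x y, x < y -> T ⟨x, y⟩ <-> C ⟨⟨x, y⟩, 1⟩).
    { intros x y Hxy; rewrite H; split.
      - intros [k [[_ Hk] | [Hk _]]]; [exact Hk | destruct (lt_asym _ _ Hxy Hk)].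
      - intro Hk; exists 0; left; split; assumption. }
    assert (Hdn : forall x y, x < y -> T ⟨y, x⟩ <-> C ⟨⟨x, y⟩, 0⟩).
    { intros x y Hxy; rewrite H; split.
      - intros [k [[Hk _] | [_ Hk]]]; [destruct (lt_asym _ _ Hxy Hk) | exact Hk].
      - intro Hk; exists 0; right; split; assumption. }
    assert (H01 : 0 <> 1)
      by (intro E; apply (succ_ne_zero 0); rewrite add_0_l; symmetry; exact E).
    assert (Htot : forall x y, x < y ->
      (T ⟨x, y⟩ /\ ~ T ⟨y, x⟩) \/ (T ⟨y, x⟩ /\ ~ T ⟨x, y⟩)).
    { intros x y Hxy; rewrite (Hup x y Hxy), (Hdn x y Hxy).
      destruct (Hcol x y Hxy) as (i & Hi & HCi & Huniq).
      apply lt_two in Hi; destruct Hi as [-> | ->]; [right | left]; split; auto;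
        intro Hc; apply Huniq in Hc; congruence. }
    exists T; split; [exact HT|]; split; [split; [exact HTrel|]; split|split].
    + intros x Hx; apply H in Hx; destruct Hx as [k [[Hx _] | [Hx _]]];
        exact (lt_irrefl x Hx).
    + intros x y Hne; destruct (lt_total x y) as [Hl | [Hl | Hl]].
      * exact (Htot x y Hl).
      * contradiction.
      * destruct (Htot y x Hl); auto.
    (* Beyond [b + x] the pair [(x, z)] is increasing and has its limit color, which decides the
       direction of the edge. *)
    + intro x; destruct (Hst x) as (i & Hi & b & Hb); exists (b + x).
      assert (Hb' : forall z, b + x < z -> x < z /\ C ⟨⟨x, z⟩, i⟩).
      { intros z Hz; assert (Hxz : x < z)
          by (apply le_lt_trans with (2 := Hz), le_exists; exists b; apply add_comm).
        split; [exact Hxz|]; apply Hb; [|exact Hxz].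
        apply le_lt_trans with (2 := Hz), le_exists; exists x; reflexivity. }
      apply lt_two in Hi; destruct Hi as [-> | ->]; [right | left]; intros z Hz;
        destruct (Hb' z Hz) as [Hxz Hc]; [apply Hdn | apply Hup]; assumption.
    + intros x y Hxy; rewrite (Hup x y Hxy), (Hdn x y Hxy); tauto.
Qed.

(** A repeated value of [F] would contradict irreflexivity of [R], so [F] is injective and hence
    unbounded, and so is its composition with [P]. On the records of that composition, numerical
    order agrees with the order of the indices. A general [R] covers ascending and descending
    sequences at once. *)
Lemma monotone_subset F P S R :
  is_set M F -> is_function F -> is_set M P -> is_function P ->
  (forall x s, P ⟨x, s⟩ -> S s /\ x < s + 1) ->
  (forall a, ~ R a a) ->
  (forall n m a b, n < m -> F ⟨n, a⟩ -> F ⟨m, b⟩ -> R a b) ->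
  exists H, is_set M H /\ unbounded H /\
    forall x y, H x -> H y -> x < y -> exists a b, P ⟨a, x⟩ /\ P ⟨b, y⟩ /\ R a b.
Proof.
  intros HF HFf HP HPf HPs Hirr Hmon.
  destruct (function_comp F P HF HP HFf HPf) as (K & HK & HKf & HKF).
  destruct (records K HK HKf) as (H & HH & Hub & Hrec).
  - intro b; destruct (injective_unbounded F b HF HFf) as (n & a & Ha & Hb).
    + intros n m a Hn Hm; destruct (lt_total n m) as [Hl | [Hl | Hl]]; [| exact Hl |];
        destruct (Hirr a); eauto.
    + destruct (HPf a) as (s & Hs & _); exists n, s; split; [apply HKF; eauto|].
      intro Hsb; apply Hb; apply le_lt_trans with (2 := Hsb), (HPs a s Hs).
  - exists H; split; [exact HH|]; split; [exact Hub|]; intros x y Hx Hy Hxy.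
    destruct (Hrec x y Hx Hy Hxy) as (n & m & Hnm & Hn & Hm).
    apply HKF in Hn, Hm; destruct Hn as (a & Ha & Hax), Hm as (b & Hb & Hby).
    exists a, b; eauto.
Qed.

Lemma models_SRT22_of_SEM_SADS : models M SEM -> models M SADS -> models M SRT22.
Proof.
  rewrite models_SEM, models_SADS, models_SRT22.
  intros HSEM HSADS C HC [[_ Hcol] Hst].
  destruct (coloring_tournament C HC Hcol Hst) as (T & HT & HTour & HTst & HTC).
  destruct (HSEM T HT (conj HTour HTst)) as (S & HS & Hinf & Htr).
  destruct (next_element S HS Hinf) as (P & HP & HPf & HPs).
  destruct HTour as (_ & Hirr & Htot).
  destruct (pullback_order T S P) as (L & HL & Hlin & HLst & HLT); auto.
  destruct (HSADS L HL (conj Hlin HLst)) as (F & HF & [_ HFf] & [Hasc | Hdesc]).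
  (* For [x < y] in [H] the order gives an edge from [x] to [y], hence color 1; the alternative
     [x = y] left open by the pullback is excluded. *)
  - destruct (monotone_subset F P S (fun a b => L ⟨a, b⟩))
      as (H & HH & Hub & HHP); auto; [apply Hlin|].
    exists H; split; [exact HH|]; split; [exact Hub|].
    exists 1; split; [apply lt_two; auto|].
    intros x y Hx Hy Hxy; apply (HTC x y Hxy).
    destruct (HHP x y Hx Hy Hxy) as (a & b & Ha & Hb & HR).
    destruct (HLT _ _ _ _ Ha Hb HR) as [|E]; [assumption|].
    rewrite E in Hxy; destruct (lt_irrefl _ Hxy).
  (* With the relation reversed the edge runs from [y] down to [x], hence color 0. *)
  - destruct (monotone_subset F P S (fun a b => L ⟨b, a⟩))
      as (H & HH & Hub & HHP); auto; [apply Hlin|].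
    exists H; split; [exact HH|]; split; [exact Hub|].
    exists 0; split; [apply lt_two; auto|].
    intros x y Hx Hy Hxy; apply (HTC x y Hxy).
    destruct (HHP x y Hx Hy Hxy) as (a & b & Ha & Hb & HR).
    destruct (HLT _ _ _ _ Hb Ha HR) as [|E]; [assumption|].
    rewrite E in Hxy; destruct (lt_irrefl _ Hxy).
Qed.

End Model.

Theorem corollary1p14 : consequence RCA0 (SEM /\ SADS -> SRT22).
Proof.
  intros M HM e E HE [HSEM HSADS].
  apply (models_SRT22_of_SEM_SADS M HM E HE); auto.
  (* [SEM] is closed, so its satisfaction under any two valuations is convertible. *)
  - intros e' E' _; exact HSEM.
  - intros e' E' _; exact HSADS.
Qed.
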